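(* Let $\Sigma\subset H^1$ be an oriented surface. Then the Gaussian curvature $K$ of the restricted metric $g_{\theta_0}|_\Sigma$ can be expressed by means of $l$, $\alpha$ and the derivatives of $\alpha$ (on the non-singular part of $\Sigma$, where these are defined) as $$K=\frac{(e_1\alpha)^2+2(1+\alpha^2)(e_1\alpha)+4\alpha^2(1+\alpha^2)-l\,(e_\Sigma\alpha)(1+\alpha^2)^{1/2}}{(1+\alpha^2)^2}.$$
   Context: $H^1$ is $\mathbb{R}^3$ with left invariant vector fields $\mathring e_1=\partial_x+y\,\partial_z$, $\mathring e_2=\partial_y-x\,\partial_z$, $T=\partial_z$, for the group law $(x_1,y_1,z_1)\circ(x_2,y_2,z_2)=(x_1+x_2,\,y_1+y_2,\,z_1+z_2+y_1x_2-x_1y_2)$. The contact form is $\theta_0=dz+x\,dy-y\,dx$, $\xi_0=\ker\theta_0=\mathrm{span}(\mathring e_1,\mathring e_2)$, and $J_0\mathring e_1=\mathring e_2$, $J_0\mathring e_2=-\mathring e_1$. The adapted metric $g_{\theta_0}=\langle\cdot,\cdot\rangle$ is the Riemannian metric for which $\mathring e_1,\mathring e_2,T$ are orthonormal. Surfaces are smooth and embedded. A point $p\in\Sigma$ is singular if $T_p\Sigma=\xi_0(p)$. On the non-singular part, let $e_1$ be a smooth unit vector field tangent to $T\Sigma\cap\xi_0$ (the characteristic foliation) and $e_2=J_0e_1$. The $p$-variation $\alpha$ is the function such that $\alpha e_2+T$ is tangent to $\Sigma$, and $e_\Sigma=(\alpha e_2+T)/\sqrt{1+\alpha^2}$. The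 $p$-mean curvature is $l=\langle D_{e_1}e_1,e_2\rangle$, where $D$ denotes componentwise differentiation of $e_1$ viewed as an $\mathbb{R}^3$-valued function (components with respect to $\partial_x,\partial_y,\partial_z$). (Replacing $e_1$ by $-e_1$ changes the signs of $\alpha$ and $l$, not of $e_\Sigma$.)
   Formalization: The formula for K is proved with an overall minus sign on the right-hand side; as printed it is false for the standard Gaussian curvature, e.g. on the plane z=0, K = -(3+2r²)/(1+r²)² while the printed expression is +(3+2r²)/(1+r²)². *)

(* Defs.v *)
From Stdlib Require Import Reals.
From Coquelicot Require Import Coquelicot.
Open Scope R_scope.

(* Points, and also tangent vectors written in components with respect to
   d/dx, d/dy, d/dz. *)
Definition R3 : Type := (R * R * R)%type.
Definition cx (p : R3) : R := fst (fst p).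
Definition cy (p : R3) : R := snd (fst p).
Definition cz (p : R3) : R := snd p.
Definition vadd (v w : R3) : R3 := (cx v + cx w, cy v + cy w, cz v + cz w).
Definition vscal (c : R) (v : R3) : R3 := (c * cx v, c * cy v, c * cz v).

Definition E1 (p : R3) : R3 := (1, 0, cy p).
Definition E2 (p : R3) : R3 := (0, 1, - cx p).
Definition TT : R3 := (0, 0, 1).

Definition theta0 (p v : R3) : R := cz v + cx p * cy v - cy p * cx v.
Definition xi0 (p v : R3) : Prop := theta0 p v = 0.

(* A vector v at p equals (cx v) E1 + (cy v) E2 + (theta0 p v) TT, whence the
   two formulas below; J0 is only used on xi0. *)
Definition metric (p v w : R3) : R :=
  cx v * cx w + cy v * cy w + theta0 p v * theta0 p w.
Definition J0 (p v : R3) : R3 :=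
  vadd (vscal (cx v) (E2 p)) (vscal (- cy v) (E1 p)).

Inductive index : Type := I1 | I2.

Definition sum2 (f : index -> R) : R := f I1 + f I2.

Definition pd (i : index) (f : R -> R -> R) (u v : R) : R :=
  match i with
  | I1 => Derive (fun s => f s v) u
  | I2 => Derive (fun s => f u s) v
  end.

Record patch : Type := Patch {
  dom : R * R -> Prop;
  param :> R -> R -> R3
}.

Definition tvec (P : patch) (i : index) (u v : R) : R3 :=
  (pd i (fun s t => cx (P s t)) u v,
   pd i (fun s t => cy (P s t)) u v,
   pd i (fun s t => cz (P s t)) u v).

Definition tcomb (P : patch) (u v c1 c2 : R) : R3 :=
  vadd (vscal c1 (tvec P I1 u v)) (vscal c2 (tvec P I2 u v)).

(* On an open set, [forall n, ex_diff_n f n] at every point means C^infinity. *)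
Definition smooth_on (D : R * R -> Prop) (f : R -> R -> R) : Prop :=
  forall u v, D (u, v) -> forall n : nat, ex_diff_n f n u v.

(* A smooth injective immersion of an open set of the plane that is a
   homeomorphism onto an open subset of Sigma; continuity of the inverse is the last
   clause: open sets are mapped to relatively open subsets of Sigma. *)
Definition local_param (Sigma : R3 -> Prop) (P : patch) : Prop :=
  open (dom P) /\
  smooth_on (dom P) (fun u v => cx (P u v)) /\
  smooth_on (dom P) (fun u v => cy (P u v)) /\
  smooth_on (dom P) (fun u v => cz (P u v)) /\
  (forall u v, dom P (u, v) ->
     forall c1 c2, tcomb P u v c1 c2 = (0, 0, 0) -> c1 = 0 /\ c2 = 0) /\
  (forall u v u' v', dom P (u, v) -> dom P (u', v') ->
     P u v = P u' v' -> u = u' /\ v = v') /\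
  (forall W : R * R -> Prop, open W -> (forall a, W a -> dom P a) ->
     exists V : R3 -> Prop, open V /\
       forall p, (Sigma p /\ V p) <-> exists u v, W (u, v) /\ P u v = p).

Definition embedded_surface (Sigma : R3 -> Prop) : Prop :=
  forall p, Sigma p ->
  exists P u v, local_param Sigma P /\ dom P (u, v) /\ P u v = p.

(* An orientation: an atlas of local parametrizations whose coordinate bases
   (tvec I1, tvec I2) are related by matrices of positive determinant. *)
Definition orientation (Sigma : R3 -> Prop) (A : patch -> Prop) : Prop :=
  (forall P, A P -> local_param Sigma P) /\
  (forall p, Sigma p -> exists P u v, A P /\ dom P (u, v) /\ P u v = p) /\
  (forall P Q u v s t, A P -> A Q -> dom P (u, v) -> dom Q (s, t) ->
     P u v = Q s t ->
     exists m11 m12 m21 m22 : R,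
       tvec P I1 u v = tcomb Q s t m11 m21 /\
       tvec P I2 u v = tcomb Q s t m12 m22 /\
       0 < m11 * m22 - m12 * m21).

Definition oriented_surface (Sigma : R3 -> Prop) (A : patch -> Prop) : Prop :=
  embedded_surface Sigma /\ orientation Sigma A.

(* The span of the coordinate vectors is the same for all local
   parametrizations around p. *)
Definition tangent (Sigma : R3 -> Prop) (p v : R3) : Prop :=
  Sigma p /\
  forall P s t, local_param Sigma P -> dom P (s, t) -> P s t = p ->
  exists c1 c2, v = tcomb P s t c1 c2.

Definition singular (Sigma : R3 -> Prop) (p : R3) : Prop :=
  Sigma p /\ forall v, tangent Sigma p v <-> xi0 p v.

Definition regular (Sigma : R3 -> Prop) (p : R3) : Prop :=
  Sigma p /\ ~ singular Sigma p.

(* Smoothness on the non-singular part of Sigma of a function, of which only the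
   values on that part matter. *)
Definition smooth_on_regular (Sigma : R3 -> Prop) (f : R3 -> R) : Prop :=
  forall P, local_param Sigma P ->
  smooth_on (fun a => dom P a /\ regular Sigma (P (fst a) (snd a)))
            (fun u v => f (P u v)).

Definition characteristic_field (Sigma : R3 -> Prop) (e1 : R3 -> R3) : Prop :=
  (forall p, regular Sigma p ->
     tangent Sigma p (e1 p) /\ xi0 p (e1 p) /\ metric p (e1 p) (e1 p) = 1) /\
  smooth_on_regular Sigma (fun p => cx (e1 p)) /\
  smooth_on_regular Sigma (fun p => cy (e1 p)) /\
  smooth_on_regular Sigma (fun p => cz (e1 p)).

Definition e2_of (e1 : R3 -> R3) (p : R3) : R3 := J0 p (e1 p).

Definition p_variation (Sigma : R3 -> Prop) (e1 : R3 -> R3) (alpha : R3 -> R) :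
  Prop :=
  forall p, regular Sigma p ->
  tangent Sigma p (vadd (vscal (alpha p) (e2_of e1 p)) TT).

Definition e_Sigma (e1 : R3 -> R3) (alpha : R3 -> R) (p : R3) : R3 :=
  vscal (/ sqrt (1 + alpha p ^ 2)) (vadd (vscal (alpha p) (e2_of e1 p)) TT).

Definition restricted_metric (P : patch) (i j : index) (u v : R) : R :=
  metric (P u v) (tvec P i u v) (tvec P j u v).

Definition det2 (h : index -> index -> R -> R -> R) (u v : R) : R :=
  h I1 I1 u v * h I2 I2 u v - h I1 I2 u v * h I2 I1 u v.

Definition inv2 (h : index -> index -> R -> R -> R) (i j : index) (u v : R) : R :=
  match i, j with
  | I1, I1 => h I2 I2 u v / det2 h u v
  | I2, I2 => h I1 I1 u v / det2 h u v
  | _, _ => - h i j u v / det2 h u v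
  end.

(* The coordinates of a tangent vector w in the basis tvec I1, tvec I2. *)
Definition tcoord (P : patch) (u v : R) (w : R3) (i : index) : R :=
  sum2 (fun j => inv2 (restricted_metric P) i j u v *
                 metric (P u v) w (tvec P j u v)).

(* The derivative at P u v, along the tangent vector w, of a function f defined
   on the surface. *)
Definition deriv_along (P : patch) (u v : R) (w : R3) (f : R3 -> R) : R :=
  sum2 (fun i => tcoord P u v w i * pd i (fun s t => f (P s t)) u v).

Definition D_along (P : patch) (u v : R) (w : R3) (X : R3 -> R3) : R3 :=
  (deriv_along P u v w (fun p => cx (X p)),
   deriv_along P u v w (fun p => cy (X p)),
   deriv_along P u v w (fun p => cz (X p))).

Definition p_mean_curvature (P : patch) (e1 : R3 -> R3) (u v : R) : R :=
  metric (P u v) (D_along P u v (e1 (P u v)) e1) (e2_of e1 (P u v)).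

Definition christoffel (h : index -> index -> R -> R -> R) (k i j : index)
  (u v : R) : R :=
  / 2 * sum2 (fun l => inv2 h k l u v *
    (pd i (h j l) u v + pd j (h i l) u v - pd l (h i j) u v)).

(* The component l of R(d_i, d_j) d_k, where
   R(X, Y) = [nabla_X, nabla_Y] - nabla_[X, Y]. *)
Definition riemann (h : index -> index -> R -> R -> R) (l i j k : index)
  (u v : R) : R :=
  pd i (christoffel h l j k) u v - pd j (christoffel h l i k) u v +
  sum2 (fun m => christoffel h l i m u v * christoffel h m j k u v -
                 christoffel h l j m u v * christoffel h m i k u v).

(* h(R(d_1, d_2) d_2, d_1) / det h, the sign for which round spheres have
   positive curvature. *)
Definition gaussian_curvature (h : index -> index -> R -> R -> R) (u v : R) : R :=
  sum2 (fun l => h I1 l u v * riemann h l I1 I2 I2 u v) / det2 h u v.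

(* Main.v *)
Require Import Defs.
From Stdlib Require Import Reals Lra Lia.
From Coquelicot Require Import Coquelicot.
Open Scope R_scope.

(* Write [e1 = cos t E1 + sin t E2].  Let [p] and [q] be the restrictions to the
   surface of [cos t dx + sin t dy] and of the contact form; since [e1] and
   [alpha e2 + T] are tangent, [- sin t dx + cos t dy] restricts to [alpha q].  With
   [f = sqrt (1 + alpha^2)], the pair [p, f q] is an orthonormal coframe, and its
   connection form is [w = - (alpha / f) (dt + 2 q)].  Since [d (alpha / f) =
   d alpha / f^3] and [d q = 2 alpha p /\ q], the curvature [d w / (p /\ f q)] involves
   only [d alpha] and [d t].  Finally [e1 t = l], and differentiating the constraint
   gives [(alpha e2 + T) t = e1 alpha + 2 alpha^2], which eliminates [t]. *)

(** * Calculus of smooth functions on an open subset of the plane *)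

(** [pd] has a value even where the derivative does not exist, so existence is recorded
    separately. *)
Definition ex_pd (i : index) (f : R -> R -> R) (u v : R) : Prop :=
  match i with
  | I1 => ex_derive (fun s => f s v) u
  | I2 => ex_derive (fun s => f u s) v
  end.

(** Fixing a finite order, unlike [smooth_on], allows induction on the order. *)
Definition diff_on (N : R * R -> Prop) (n : nat) (f : R -> R -> R) : Prop :=
  forall u v, N (u, v) -> ex_diff_n f n u v.

Lemma open_locally_2d (N : R * R -> Prop) (Q : R -> R -> Prop) :
  open N -> (forall u v, N (u, v) -> Q u v) ->
  forall u v, N (u, v) -> locally_2d Q u v.
Proof.
  intros HN HQ u v Huv. apply locally_2d_locally.
  apply (filter_imp N); [ intros [s t]; apply HQ | exact (HN _ Huv) ].
Qed.

(** Serves to differentiate identities that hold on [N]: openness makes them hold near the point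
    along both coordinate lines. *)
Lemma pd_ext_on (N : R * R -> Prop) (i : index) (f g : R -> R -> R) :
  open N -> (forall u v, N (u, v) -> f u v = g u v) ->
  forall u v, N (u, v) -> pd i f u v = pd i g u v.
Proof.
  intros HN H u v Huv. pose proof (open_locally_2d N _ HN H u v Huv) as L.
  destruct i; apply Derive_ext_loc.
  - exact (locally_2d_1d_const_y _ _ _ L).
  - exact (locally_2d_1d_const_x _ _ _ L).
Qed.

Lemma diff_on_ext (N : R * R -> Prop) (n : nat) (f g : R -> R -> R) :
  open N -> (forall u v, N (u, v) -> f u v = g u v) ->
  diff_on N n f -> diff_on N n g.
Proof.
  intros HN H Hf u v Huv. apply (ex_diff_n_ext_loc f); [ | now apply Hf ].
  now apply (open_locally_2d N).
Qed.

Lemma diff_on_le (N : R * R -> Prop) (m n : nat) (f : R -> R -> R) :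
  (m <= n)%nat -> diff_on N n f -> diff_on N m f.
Proof. intros H Hf u v Huv. now apply (ex_diff_n_m n m H), Hf. Qed.

Lemma diff_on_continuity (N : R * R -> Prop) (n : nat) (f : R -> R -> R) :
  diff_on N n f -> forall u v, N (u, v) -> continuity_2d_pt f u v.
Proof. intros H u v Huv. specialize (H u v Huv). destruct n; apply H. Qed.

Lemma diff_on_ex_pd (N : R * R -> Prop) (n : nat) (f : R -> R -> R) (i : index) :
  diff_on N (S n) f -> forall u v, N (u, v) -> ex_pd i f u v.
Proof. intros H u v Huv. specialize (H u v Huv). destruct i; apply H. Qed.

Lemma diff_on_pd (N : R * R -> Prop) (n : nat) (f : R -> R -> R) (i : index) :
  diff_on N (S n) f -> diff_on N n (pd i f).
Proof. intros H u v Huv. specialize (H u v Huv). destruct i; apply H. Qed.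

Lemma diff_on_S (N : R * R -> Prop) (n : nat) (f : R -> R -> R) :
  (forall u v, N (u, v) -> continuity_2d_pt f u v) ->
  (forall i u v, N (u, v) -> ex_pd i f u v) ->
  (forall i, diff_on N n (pd i f)) -> diff_on N (S n) f.
Proof.
  intros Hc He Hd u v Huv. split; [ now apply Hc | ].
  split; [ exact (He I1 u v Huv) | ].
  split; [ exact (He I2 u v Huv) | ].
  split; [ exact (Hd I1 u v Huv) | exact (Hd I2 u v Huv) ].
Qed.

Lemma pd_plus_pt (i : index) (f g : R -> R -> R) (u v : R) :
  ex_pd i f u v -> ex_pd i g u v ->
  ex_pd i (fun s t => f s t + g s t) u v /\
  pd i (fun s t => f s t + g s t) u v = pd i f u v + pd i g u v.
Proof.
  destruct i; intros Hf Hg; split.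
  - exact (ex_derive_plus _ _ _ Hf Hg).
  - exact (Derive_plus _ _ _ Hf Hg).
  - exact (ex_derive_plus _ _ _ Hf Hg).
  - exact (Derive_plus _ _ _ Hf Hg).
Qed.

Lemma pd_mult_pt (i : index) (f g : R -> R -> R) (u v : R) :
  ex_pd i f u v -> ex_pd i g u v ->
  ex_pd i (fun s t => f s t * g s t) u v /\
  pd i (fun s t => f s t * g s t) u v = pd i f u v * g u v + f u v * pd i g u v.
Proof.
  destruct i; intros Hf Hg; split.
  - exact (ex_derive_mult _ _ _ Hf Hg).
  - exact (Derive_mult _ _ _ Hf Hg).
  - exact (ex_derive_mult _ _ _ Hf Hg).
  - exact (Derive_mult _ _ _ Hf Hg).
Qed.

Lemma pd_comp_pt (i : index) (F : R -> R) (f : R -> R -> R) (u v d : R) :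
  ex_pd i f u v -> is_derive F (f u v) d ->
  ex_pd i (fun s t => F (f s t)) u v /\
  pd i (fun s t => F (f s t)) u v = pd i f u v * d.
Proof.
  destruct i; intros Hf HF.
  - pose proof (is_derive_comp F (fun s => f s v) u d _ HF (Derive_correct _ _ Hf)) as H.
    split; [ eexists; exact H | exact (is_derive_unique _ _ _ H) ].
  - pose proof (is_derive_comp F (fun s => f u s) v d _ HF (Derive_correct _ _ Hf)) as H.
    split; [ eexists; exact H | exact (is_derive_unique _ _ _ H) ].
Qed.

Lemma pd_const (i : index) (k u v : R) : pd i (fun _ _ => k) u v = 0.
Proof. destruct i; exact (Derive_const k _). Qed.

Lemma diff_on_const (N : R * R -> Prop) (n : nat) (k : R) :
  open N -> diff_on N n (fun _ _ => k).
Proof.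
  intros HN. revert k. induction n as [|n IH]; intros k.
  - intros u v _. split; [ apply continuity_2d_pt_const | exact I ].
  - apply diff_on_S.
    + intros; apply continuity_2d_pt_const.
    + intros [] u v _; exact (ex_derive_const k _).
    + intros i. apply (diff_on_ext N n (fun _ _ => 0)); auto.
      intros; now rewrite pd_const.
Qed.

Lemma diff_on_plus (N : R * R -> Prop) (n : nat) (f g : R -> R -> R) :
  open N -> diff_on N n f -> diff_on N n g ->
  diff_on N n (fun u v => f u v + g u v).
Proof.
  intros HN. revert f g. induction n as [|n IH]; intros f g Hf Hg.
  - intros u v Huv. split; [ | exact I ].
    apply continuity_2d_pt_plus; now apply (diff_on_continuity N 0).
  - apply diff_on_S.
    + intros u v Huv. apply continuity_2d_pt_plus; now apply (diff_on_continuity N (S n)).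
    + intros i u v Huv. apply pd_plus_pt; now apply (diff_on_ex_pd N n).
    + intros i. apply (diff_on_ext N n (fun u v => pd i f u v + pd i g u v)); auto.
      * intros u v Huv. symmetry. apply pd_plus_pt; now apply (diff_on_ex_pd N n).
      * apply IH; now apply diff_on_pd.
Qed.

(** The Leibniz rule pairs a derivative with an undifferentiated factor, whose order [diff_on_le]
    lowers before the induction hypothesis applies. *)
Lemma diff_on_mult (N : R * R -> Prop) (n : nat) (f g : R -> R -> R) :
  open N -> diff_on N n f -> diff_on N n g ->
  diff_on N n (fun u v => f u v * g u v).
Proof.
  intros HN. revert f g. induction n as [|n IH]; intros f g Hf Hg.
  - intros u v Huv. split; [ | exact I ].
    apply continuity_2d_pt_mult; now apply (diff_on_continuity N 0).
  - apply diff_on_S.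
    + intros u v Huv. apply continuity_2d_pt_mult; now apply (diff_on_continuity N (S n)).
    + intros i u v Huv. apply pd_mult_pt; now apply (diff_on_ex_pd N n).
    + intros i.
      apply (diff_on_ext N n (fun u v => pd i f u v * g u v + f u v * pd i g u v)); auto.
      * intros u v Huv. symmetry. apply pd_mult_pt; now apply (diff_on_ex_pd N n).
      * assert (n <= S n)%nat by lia.
        apply diff_on_plus; auto; apply IH;
          (now apply diff_on_pd) || now apply (diff_on_le N n (S n)).
Qed.

(** The derivative of [/ f] is a product of [pd i f] with copies of [/ f] itself, which the
    induction hypothesis covers at the lower order. The square root below works the same way. *)
Lemma diff_on_inv (N : R * R -> Prop) (n : nat) (f : R -> R -> R) :
  open N -> (forall u v, N (u, v) -> f u v <> 0) -> diff_on N n f ->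
  diff_on N n (fun u v => / f u v).
Proof.
  intros HN H0. induction n as [|n IH]; intros Hf.
  - intros u v Huv. split; [ | exact I ].
    apply continuity_2d_pt_inv; [ now apply (diff_on_continuity N 0) | auto ].
  - assert (Hpd : forall i u v, N (u, v) ->
      ex_pd i (fun s t => / f s t) u v /\
      pd i (fun s t => / f s t) u v = pd i f u v * (-1 * (/ f u v * / f u v))).
    { intros i u v Huv. pose proof (H0 u v Huv).
      apply pd_comp_pt; [ now apply (diff_on_ex_pd N n) | ].
      auto_derive; [ assumption | field; assumption ]. }
    assert (Hf' : diff_on N n f) by (apply (diff_on_le N n (S n)); auto).
    apply diff_on_S.
    + intros u v Huv.
      apply continuity_2d_pt_inv; [ now apply (diff_on_continuity N (S n)) | auto ].
    + intros i u v Huv. now apply Hpd.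
    + intros i. eapply diff_on_ext; [ assumption | | ].
      * intros u v Huv. symmetry. now apply Hpd.
      * repeat apply diff_on_mult; auto using diff_on_const, diff_on_pd.
Qed.

Lemma diff_on_sqrt (N : R * R -> Prop) (n : nat) (f : R -> R -> R) :
  open N -> (forall u v, N (u, v) -> 0 < f u v) -> diff_on N n f ->
  diff_on N n (fun u v => sqrt (f u v)).
Proof.
  intros HN H0.
  assert (Hc : forall m, diff_on N m f -> forall u v, N (u, v) ->
     continuity_2d_pt (fun s t => sqrt (f s t)) u v).
  { intros m Hf u v Huv. apply continuity_1d_2d_pt_comp.
    - apply continuity_pt_sqrt. apply Rlt_le; auto.
    - now apply (diff_on_continuity N m). }
  induction n as [|n IH]; intros Hf.
  - intros u v Huv. split; [ now apply (Hc 0%nat) | exact I ].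
  - assert (Hpd : forall i u v, N (u, v) ->
      ex_pd i (fun s t => sqrt (f s t)) u v /\
      pd i (fun s t => sqrt (f s t)) u v = pd i f u v * (/ 2 * / sqrt (f u v))).
    { intros i u v Huv. pose proof (H0 u v Huv).
      apply pd_comp_pt; [ now apply (diff_on_ex_pd N n) | ].
      pose proof (sqrt_lt_R0 _ H).
      auto_derive; [ assumption | field; lra ]. }
    assert (Hf' : diff_on N n f) by (apply (diff_on_le N n (S n)); auto).
    apply diff_on_S.
    + now apply (Hc (S n)).
    + intros i u v Huv. now apply Hpd.
    + intros i. eapply diff_on_ext; [ assumption | | ].
      * intros u v Huv. symmetry. now apply Hpd.
      * repeat apply diff_on_mult; auto using diff_on_const, diff_on_pd.
        apply diff_on_inv; auto.
        intros u v Huv. apply Rgt_not_eq, sqrt_lt_R0; auto.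
Qed.

(** * Closure properties of smooth functions and symmetry of second derivatives *)

Section Smooth.

Variable N : R * R -> Prop.
Hypothesis HN : open N.

Lemma smooth_on_diff_on (f : R -> R -> R) :
  smooth_on N f <-> forall n, diff_on N n f.
Proof. split; [ intros H n u v Huv | intros H u v Huv n ]; now apply H. Qed.

Lemma smooth_on_ext (f g : R -> R -> R) :
  (forall u v, N (u, v) -> f u v = g u v) -> smooth_on N f -> smooth_on N g.
Proof.
  rewrite !smooth_on_diff_on. intros H Hf n. now apply (diff_on_ext N n f).
Qed.

Lemma smooth_on_pd (i : index) (f : R -> R -> R) :
  smooth_on N f -> smooth_on N (pd i f).
Proof.
  intros H. apply smooth_on_diff_on. intros n.
  apply diff_on_pd. now apply smooth_on_diff_on.
Qed.

Lemma smooth_on_const (k : R) : smooth_on N (fun _ _ => k).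
Proof. rewrite smooth_on_diff_on. intros n. now apply diff_on_const. Qed.

Lemma smooth_on_plus (f g : R -> R -> R) :
  smooth_on N f -> smooth_on N g -> smooth_on N (fun u v => f u v + g u v).
Proof. rewrite !smooth_on_diff_on. intros Hf Hg n. now apply diff_on_plus. Qed.

Lemma smooth_on_mult (f g : R -> R -> R) :
  smooth_on N f -> smooth_on N g -> smooth_on N (fun u v => f u v * g u v).
Proof. rewrite !smooth_on_diff_on. intros Hf Hg n. now apply diff_on_mult. Qed.

Lemma smooth_on_opp (f : R -> R -> R) :
  smooth_on N f -> smooth_on N (fun u v => - f u v).
Proof.
  intros Hf. apply (smooth_on_ext (fun u v => (-1) * f u v)); [ intros; ring | ].
  apply smooth_on_mult; auto using smooth_on_const.
Qed.

Lemma smooth_on_minus (f g : R -> R -> R) :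
  smooth_on N f -> smooth_on N g -> smooth_on N (fun u v => f u v - g u v).
Proof. intros Hf Hg. apply (smooth_on_plus f); auto using smooth_on_opp. Qed.

Lemma smooth_on_inv (f : R -> R -> R) :
  (forall u v, N (u, v) -> f u v <> 0) ->
  smooth_on N f -> smooth_on N (fun u v => / f u v).
Proof. rewrite !smooth_on_diff_on. intros H Hf n. now apply diff_on_inv. Qed.

Lemma smooth_on_div (f g : R -> R -> R) :
  (forall u v, N (u, v) -> g u v <> 0) ->
  smooth_on N f -> smooth_on N g -> smooth_on N (fun u v => f u v / g u v).
Proof. intros H Hf Hg. apply (smooth_on_mult f); auto using smooth_on_inv. Qed.

Lemma smooth_on_sqrt (f : R -> R -> R) :
  (forall u v, N (u, v) -> 0 < f u v) ->
  smooth_on N f -> smooth_on N (fun u v => sqrt (f u v)).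
Proof. rewrite !smooth_on_diff_on. intros H Hf n. now apply diff_on_sqrt. Qed.

Lemma smooth_on_ex_pd (i : index) (f : R -> R -> R) (u v : R) :
  smooth_on N f -> N (u, v) -> ex_pd i f u v.
Proof. rewrite smooth_on_diff_on. intros H. now apply (diff_on_ex_pd N 0). Qed.

Lemma pd_plus (i : index) (f g : R -> R -> R) (u v : R) :
  N (u, v) -> smooth_on N f -> smooth_on N g ->
  pd i (fun s t => f s t + g s t) u v = pd i f u v + pd i g u v.
Proof. intros. apply pd_plus_pt; now apply smooth_on_ex_pd. Qed.

Lemma pd_mult (i : index) (f g : R -> R -> R) (u v : R) :
  N (u, v) -> smooth_on N f -> smooth_on N g ->
  pd i (fun s t => f s t * g s t) u v = pd i f u v * g u v + f u v * pd i g u v.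
Proof. intros. apply pd_mult_pt; now apply smooth_on_ex_pd. Qed.

Lemma pd_opp (i : index) (f : R -> R -> R) (u v : R) :
  pd i (fun s t => - f s t) u v = - pd i f u v.
Proof. destruct i; exact (Derive_opp _ _). Qed.

Lemma pd_minus (i : index) (f g : R -> R -> R) (u v : R) :
  N (u, v) -> smooth_on N f -> smooth_on N g ->
  pd i (fun s t => f s t - g s t) u v = pd i f u v - pd i g u v.
Proof.
  intros. unfold Rminus. rewrite <- pd_opp.
  apply (pd_plus i f (fun s t => - g s t)); auto using smooth_on_opp.
Qed.

Lemma pd_comm (f : R -> R -> R) (u v : R) :
  smooth_on N f -> N (u, v) -> pd I2 (pd I1 f) u v = pd I1 (pd I2 f) u v.
Proof.
  intros Hf Huv. symmetry. apply (Schwarz f u v).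
  - revert u v Huv. apply open_locally_2d; auto. intros u v Huv.
    assert (H1 := fun i => smooth_on_ex_pd i f u v Hf Huv).
    assert (H2 := fun i j => smooth_on_ex_pd i (pd j f) u v (smooth_on_pd j f Hf) Huv).
    split; [ exact (H1 I1) | split; [ exact (H1 I2) | split; [ exact (H2 I1 I2) | exact (H2 I2 I1) ] ] ].
  (* Order [0] of [ex_diff_n] is continuity, here of the mixed derivatives. *)
  - exact (proj1 (smooth_on_pd I1 _ (smooth_on_pd I2 f Hf) u v Huv 0%nat)).
  - exact (proj1 (smooth_on_pd I2 _ (smooth_on_pd I1 f Hf) u v Huv 0%nat)).
Qed.

End Smooth.

(** The constant case matches only bodies free of both variables; atoms and nonvanishing conditions
    are left to [auto]. *)
Ltac smooth :=
  lazymatch goal with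
  | |- smooth_on _ (fun _ _ => _ + _) => apply smooth_on_plus; smooth
  | |- smooth_on _ (fun _ _ => _ - _) => apply smooth_on_minus; smooth
  | |- smooth_on _ (fun _ _ => _ * _) => apply smooth_on_mult; smooth
  | |- smooth_on _ (fun _ _ => _ / _) => apply smooth_on_div; smooth
  | |- smooth_on _ (fun _ _ => - _) => apply smooth_on_opp; smooth
  | |- smooth_on _ (fun u v => pd ?i ?f u v) => change (smooth_on _ (pd i f)); smooth
  | |- smooth_on _ (pd _ _) => apply smooth_on_pd; smooth
  | |- smooth_on _ (fun _ _ => ?k) => apply smooth_on_const; smooth
  | |- open _ => assumption
  | |- _ => auto
  end.

Ltac pd_simpl N :=
  repeat first
    [ rewrite (pd_plus N) by smooth
    | rewrite (pd_minus N) by smooth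
    | rewrite (pd_mult N) by smooth
    | rewrite pd_opp
    | rewrite pd_const ].

(** * Curvature from an orthonormal coframe and its connection form *)

Section Cartan.

(** [p i], [r i], [w i] are the values of one-forms on the [i]-th coordinate vector, and [delta] is
    [p /\ r] on the coordinate basis. [Hdp] and [Hdr] are the structure equations [dp = - w /\ r]
    and [dr = w /\ p]. *)
Variables (N : R * R -> Prop) (p r w : index -> R -> R -> R)
  (h : index -> index -> R -> R -> R).
Hypotheses (HN : open N)
  (Sp : forall i, smooth_on N (p i)) (Sr : forall i, smooth_on N (r i))
  (Sw : forall i, smooth_on N (w i)).
Let delta u v := p I1 u v * r I2 u v - p I2 u v * r I1 u v.
Hypotheses (Hdelta : forall u v, N (u, v) -> delta u v <> 0)
  (Hh : forall i j u v, N (u, v) ->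
     h i j u v = p i u v * p j u v + r i u v * r j u v)
  (Hdp : forall u v, N (u, v) ->
     pd I1 (p I2) u v - pd I2 (p I1) u v =
     - (w I1 u v * r I2 u v - w I2 u v * r I1 u v))
  (Hdr : forall u v, N (u, v) ->
     pd I1 (r I2) u v - pd I2 (r I1) u v =
     w I1 u v * p I2 u v - w I2 u v * p I1 u v).

(* The components along [p] and [r] of the covariant derivative of the [j]-th
   coordinate vector in the [i]-th direction, as prescribed by [w]. *)
Let U i j u v := pd i (p j) u v + w i u v * r j u v.
Let V i j u v := pd i (r j) u v - w i u v * p j u v.

(** Cramer's rule for the coordinates of the vector with components [U] along [p] and [V] along
    [r]. *)
Let G (k i j : index) u v :=
  match k with
  | I1 => (U i j u v * r I2 u v - V i j u v * p I2 u v) / delta u v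
  | I2 => (p I1 u v * V i j u v - r I1 u v * U i j u v) / delta u v
  end.

(** The connection prescribed by [w] is metric because [w] enters [U] and [V] antisymmetrically, and
    torsion-free by the structure equations; hence it is the Levi-Civita connection. The proof
    checks this index by index as a rational identity. *)
Lemma christoffel_coframe (k i j : index) (u v : R) :
  N (u, v) -> christoffel h k i j u v = G k i j u v.
Proof.
  intros Huv.
  assert (Hpd : forall m a b, pd m (h a b) u v =
    pd m (p a) u v * p b u v + p a u v * pd m (p b) u v +
    (pd m (r a) u v * r b u v + r a u v * pd m (r b) u v)).
  { intros m a b.
    rewrite (pd_ext_on N m (h a b) (fun u v => p a u v * p b u v + r a u v * r b u v));
      auto.
    pd_simpl N. reflexivity. }
  assert (Hdet : det2 h u v = delta u v * delta u v).
  { unfold det2, delta. rewrite !Hh by assumption. ring. }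
  pose proof (Hdelta u v Huv) as Hd.
  pose proof (Hdp u v Huv) as Ep. pose proof (Hdr u v Huv) as Er.
  (* Solved for one mixed term each, the structure equations can be used as rewrite rules. *)
  assert (Ep' : pd I1 (p I2) u v = pd I2 (p I1) u v
     - (w I1 u v * r I2 u v - w I2 u v * r I1 u v)) by lra.
  assert (Er' : pd I1 (r I2) u v = pd I2 (r I1) u v
     + (w I1 u v * p I2 u v - w I2 u v * p I1 u v)) by lra.
  unfold christoffel, sum2, G, U, V.
  destruct k, i, j; cbn [inv2]; rewrite !Hpd, Hdet, !Hh by assumption;
    rewrite ?Ep', ?Er'; unfold delta in *; field; assumption.
Qed.

(** The vector [R(d_1, d_2) d_2] has [p]-component [dw * r I2] and [r]-component [- dw * p I2];
    pairing it with [d_1] gives [dw * delta], while [det h = delta^2]. *)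
Lemma curvature_coframe (u v : R) :
  N (u, v) ->
  gaussian_curvature h u v = (pd I1 (w I2) u v - pd I2 (w I1) u v) / delta u v.
Proof.
  intros Huv.
  assert (SU : forall i j, smooth_on N (U i j)) by (intros; unfold U; smooth).
  assert (SV : forall i j, smooth_on N (V i j)) by (intros; unfold V; smooth).
  assert (SG : forall k i j, smooth_on N (G k i j)).
  { intros [] i j; unfold G, delta; smooth. }
  assert (Hdet : det2 h u v = delta u v * delta u v).
  { unfold det2, delta. rewrite !Hh by assumption. ring. }
  (* Differentiating these linear relations, instead of the quotients in [G], keeps derivatives of
     [delta] out of the computation. *)
  assert (GU : forall i j s t, N (s, t) ->
    p I1 s t * G I1 i j s t + p I2 s t * G I2 i j s t = U i j s t).
  { intros i j s t Hst. pose proof (Hdelta s t Hst). unfold G, delta in *. field. assumption. }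
  assert (GV : forall i j s t, N (s, t) ->
    r I1 s t * G I1 i j s t + r I2 s t * G I2 i j s t = V i j s t).
  { intros i j s t Hst. pose proof (Hdelta s t Hst). unfold G, delta in *. field. assumption. }
  assert (DU : forall m i j,
    pd m (p I1) u v * G I1 i j u v + p I1 u v * pd m (G I1 i j) u v +
    (pd m (p I2) u v * G I2 i j u v + p I2 u v * pd m (G I2 i j) u v) =
    pd m (pd i (p j)) u v + (pd m (w i) u v * r j u v + w i u v * pd m (r j) u v)).
  { intros m i j.
    pose proof (pd_ext_on N m _ _ HN (GU i j) u v Huv) as E.
    unfold U in E at 1. revert E. pd_simpl N. intros E. exact E. }
  assert (DV : forall m i j,
    pd m (r I1) u v * G I1 i j u v + r I1 u v * pd m (G I1 i j) u v +
    (pd m (r I2) u v * G I2 i j u v + r I2 u v * pd m (G I2 i j) u v) =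
    pd m (pd i (r j)) u v - (pd m (w i) u v * p j u v + w i u v * pd m (p j) u v)).
  { intros m i j.
    pose proof (pd_ext_on N m _ _ HN (GV i j) u v Huv) as E.
    unfold V in E at 1. revert E. pd_simpl N. intros E. exact E. }
  pose proof (Hdelta u v Huv) as Hd.
  set (dw := pd I1 (w I2) u v - pd I2 (w I1) u v).
  assert (Hriem : forall l, riemann h l I1 I2 I2 u v =
    pd I1 (G l I2 I2) u v - pd I2 (G l I1 I2) u v +
    sum2 (fun m => G l I1 m u v * G m I2 I2 u v - G l I2 m u v * G m I1 I2 u v)).
  { intros l. unfold riemann, sum2.
    rewrite !christoffel_coframe by assumption.
    rewrite (pd_ext_on N I1 (christoffel h l I2 I2) (G l I2 I2)),
      (pd_ext_on N I2 (christoffel h l I1 I2) (G l I1 I2)); auto;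
    intros; now apply christoffel_coframe. }
  assert (RU : p I1 u v * riemann h I1 I1 I2 I2 u v + p I2 u v * riemann h I2 I1 I2 I2 u v
    = dw * r I2 u v).
  { rewrite !Hriem. unfold sum2.
    pose proof (DU I1 I2 I2) as D1. pose proof (DU I2 I1 I2) as D2.
    rewrite (pd_comm N) in D2 by auto.
    (* [lra] treats products as atoms, so the quadratic terms of the curvature are supplied as
       multiples of [GU] and [GV]. *)
    pose proof (f_equal (Rmult (G I1 I2 I2 u v)) (GU I1 I1 u v Huv)) as A11.
    pose proof (f_equal (Rmult (G I2 I2 I2 u v)) (GU I1 I2 u v Huv)) as A12.
    pose proof (f_equal (Rmult (G I1 I1 I2 u v)) (GU I2 I1 u v Huv)) as A21.
    pose proof (f_equal (Rmult (G I2 I1 I2 u v)) (GU I2 I2 u v Huv)) as A22.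
    pose proof (f_equal (Rmult (w I1 u v)) (GV I2 I2 u v Huv)) as B1.
    pose proof (f_equal (Rmult (w I2 u v)) (GV I1 I2 u v Huv)) as B2.
    unfold U, V, dw in *. lra. }
  assert (RV : r I1 u v * riemann h I1 I1 I2 I2 u v + r I2 u v * riemann h I2 I1 I2 I2 u v
    = - dw * p I2 u v).
  { rewrite !Hriem. unfold sum2.
    pose proof (DV I1 I2 I2) as D1. pose proof (DV I2 I1 I2) as D2.
    rewrite (pd_comm N) in D2 by auto.
    pose proof (f_equal (Rmult (G I1 I2 I2 u v)) (GV I1 I1 u v Huv)) as A11.
    pose proof (f_equal (Rmult (G I2 I2 I2 u v)) (GV I1 I2 u v Huv)) as A12.
    pose proof (f_equal (Rmult (G I1 I1 I2 u v)) (GV I2 I1 u v Huv)) as A21.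
    pose proof (f_equal (Rmult (G I2 I1 I2 u v)) (GV I2 I2 u v Huv)) as A22.
    pose proof (f_equal (Rmult (w I1 u v)) (GU I2 I2 u v Huv)) as B1.
    pose proof (f_equal (Rmult (w I2 u v)) (GU I1 I2 u v Huv)) as B2.
    unfold U, V, dw in *. lra. }
  unfold gaussian_curvature, sum2. rewrite Hdet, !Hh by assumption.
  replace (_ + _) with (dw * delta u v); [ field; assumption | ].
  transitivity (p I1 u v * (dw * r I2 u v) + r I1 u v * (- dw * p I2 u v)).
  - unfold delta. ring.
  - rewrite <- RU, <- RV. ring.
Qed.

End Cartan.

(** * Surfaces in the Heisenberg group *)

Section AdaptedFrame.

Variables (N : R * R -> Prop) (x y z c s al : R -> R -> R)
  (h : index -> index -> R -> R -> R).
Hypotheses (HN : open N)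
  (Sx : smooth_on N x) (Sy : smooth_on N y) (Sz : smooth_on N z)
  (Sc : smooth_on N c) (Ss : smooth_on N s) (Sal : smooth_on N al).
Let p i u v := c u v * pd i x u v + s u v * pd i y u v.
Let q i u v := pd i z u v + x u v * pd i y u v - y u v * pd i x u v.
(* [phi] is the differential of the angle of [(c, s)]; working with it avoids
   choosing the angle itself. *)
Let phi i u v := c u v * pd i s u v - s u v * pd i c u v.
Let Delta u v := p I1 u v * q I2 u v - p I2 u v * q I1 u v.
Hypotheses (Hcs : forall u v, N (u, v) -> c u v * c u v + s u v * s u v = 1)
  (Hal : forall i u v, N (u, v) ->
     - s u v * pd i x u v + c u v * pd i y u v = al u v * q i u v)
  (HDelta : forall u v, N (u, v) -> Delta u v <> 0)
  (Hh : forall i j u v, N (u, v) -> h i j u v =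
     pd i x u v * pd j x u v + pd i y u v * pd j y u v + q i u v * q j u v).

Let f u v := sqrt (1 + al u v * al u v).
Let g u v := al u v / f u v.
Let w i u v := - (g u v * (phi i u v + 2 * q i u v)).
Let r i u v := f u v * q i u v.

(** The basis dual to [p, q] is [e1, alpha e2 + T], with coordinates [(q I2, - q I1) / Delta] and
    [(- p I2, p I1) / Delta]. Thus [e1a] and [wa] are the derivatives of [al] along these two
    vectors, and [l] is [phi] evaluated on [e1]. *)
Lemma curvature_adapted_frame (u v : R) (e1a wa l : R) :
  N (u, v) ->
  e1a = (q I2 u v * pd I1 al u v - q I1 u v * pd I2 al u v) / Delta u v ->
  wa = (p I1 u v * pd I2 al u v - p I2 u v * pd I1 al u v) / Delta u v ->
  l = (q I2 u v * phi I1 u v - q I1 u v * phi I2 u v) / Delta u v ->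
  gaussian_curvature h u v =
  - ((e1a ^ 2 + 2 * (1 + al u v ^ 2) * e1a + 4 * al u v ^ 2 * (1 + al u v ^ 2)
      - l * wa) / (1 + al u v ^ 2) ^ 2).
Proof.
  intros Huv He Hwa Hl.
  assert (F0 : forall u v, 0 < 1 + al u v * al u v)
    by (intros a b; pose proof (Rle_0_sqr (al a b)); unfold Rsqr in *; lra).
  assert (f0 : forall u v, 0 < f u v) by (intros; apply sqrt_lt_R0, F0).
  assert (f1 : forall u v, f u v <> 0) by (intros; apply Rgt_not_eq, f0).
  assert (ff : forall u v, f u v * f u v = 1 + al u v * al u v)
    by (intros; apply sqrt_sqrt, Rlt_le, F0).
  assert (gf : forall u v, g u v * f u v = al u v) by (intros; unfold g; field; apply f1).
  assert (Sf : smooth_on N f) by (unfold f; apply smooth_on_sqrt; smooth).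
  assert (Sg : smooth_on N g) by (unfold g; smooth).
  assert (Sp : forall i, smooth_on N (p i)) by (intros; unfold p; smooth).
  assert (Sq : forall i, smooth_on N (q i)) by (intros; unfold q; smooth).
  assert (Sphi : forall i, smooth_on N (phi i)) by (intros; unfold phi; smooth).
  assert (Sr : forall i, smooth_on N (r i)) by (intros; unfold r; smooth).
  assert (Sw : forall i, smooth_on N (w i)) by (intros; unfold w; smooth).
  (* Differentiating [f * f = 1 + al * al] and [g * f = al] avoids the derivatives of a root and a
     quotient. *)
  assert (Df : forall i a b, N (a, b) -> f a b * pd i f a b = al a b * pd i al a b).
  { intros i a b Hab.
    pose proof (pd_ext_on N i _ _ HN (fun a b _ => ff a b) a b Hab) as E.
    revert E. pd_simpl N. lra. }
  assert (Dg : forall i a b, N (a, b) ->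
     pd i g a b * f a b + g a b * pd i f a b = pd i al a b).
  { intros i a b Hab.
    pose proof (pd_ext_on N i _ _ HN (fun a b _ => gf a b) a b Hab) as E.
    revert E. pd_simpl N. lra. }
  (* On the unit circle the derivative of [(c, s)] is [phi] times the quarter turn [(- s, c)]. *)
  assert (Dcs : forall i a b, N (a, b) ->
     pd i c a b = - s a b * phi i a b /\ pd i s a b = c a b * phi i a b).
  { intros i a b Hab. pose proof (Hcs a b Hab) as E0.
    pose proof (pd_ext_on N i _ _ HN Hcs a b Hab) as E. revert E.
    pd_simpl N. intros E.
    assert (E' : c a b * pd i c a b + s a b * pd i s a b = 0) by lra.
    unfold phi. split.
    - transitivity ((c a b * c a b + s a b * s a b) * pd i c a b
        - c a b * (c a b * pd i c a b + s a b * pd i s a b)).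
      + rewrite E0, E'. ring.
      + ring.
    - transitivity ((c a b * c a b + s a b * s a b) * pd i s a b
        - s a b * (c a b * pd i c a b + s a b * pd i s a b)).
      + rewrite E0, E'. ring.
      + ring. }
  (* [dq = 2 dx /\ dy], and the rotation by [(c, s)] preserves area, so [dx /\ dy = p /\ (al q)]. *)
  assert (Dq : forall a b, N (a, b) ->
     pd I1 (q I2) a b - pd I2 (q I1) a b = 2 * al a b * Delta a b).
  { intros a b Hab.
    transitivity (2 * (pd I1 x a b * pd I2 y a b - pd I2 x a b * pd I1 y a b)).
    - unfold q. pd_simpl N. rewrite !(pd_comm N) by auto. ring.
    - transitivity (2 * (p I1 a b * (al a b * q I2 a b) - p I2 a b * (al a b * q I1 a b))).
      + rewrite <- !Hal by assumption. unfold p.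
        rewrite <- (Rmult_1_l (_ - _)), <- (Hcs a b Hab) at 1. ring.
      + unfold Delta. ring. }
  (* [dp = phi /\ (- s dx + c dy)], and the second factor is [al q]. *)
  assert (Dp : forall a b, N (a, b) -> pd I1 (p I2) a b - pd I2 (p I1) a b =
     al a b * (phi I1 a b * q I2 a b - phi I2 a b * q I1 a b)).
  { intros a b Hab.
    transitivity (phi I1 a b * (al a b * q I2 a b) - phi I2 a b * (al a b * q I1 a b));
      [ | ring ].
    rewrite <- !Hal by assumption.
    unfold p. pd_simpl N. rewrite !(pd_comm N) by auto.
    destruct (Dcs I1 a b Hab) as [-> ->]. destruct (Dcs I2 a b Hab) as [-> ->]. ring. }
  (* Exterior derivative of the constraint [- s dx + c dy = al q]: the left side gives [- phi /\ p],
     the right side [d al /\ q + al dq]. *)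
  assert (Dal : forall a b, N (a, b) ->
     - (phi I1 a b * p I2 a b - phi I2 a b * p I1 a b) =
     pd I1 al a b * q I2 a b - pd I2 al a b * q I1 a b
     + 2 * al a b * al a b * Delta a b).
  { intros a b Hab.
    pose proof (pd_ext_on N I1 _ _ HN (Hal I2) a b Hab) as E1.
    pose proof (pd_ext_on N I2 _ _ HN (Hal I1) a b Hab) as E2.
    revert E1 E2. pd_simpl N. rewrite !(pd_comm N) by auto.
    destruct (Dcs I1 a b Hab) as [-> ->]. destruct (Dcs I2 a b Hab) as [-> ->].
    intros E1 E2. pose proof (f_equal (Rmult (al a b)) (Dq a b Hab)) as E3.
    unfold p. lra. }
  (* [d phi = 2 dc /\ ds], which vanishes since [dc] and [ds] are both multiples of [phi]. *)
  assert (Dphi : pd I1 (phi I2) u v - pd I2 (phi I1) u v = 0).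
  { transitivity (2 * (pd I1 c u v * pd I2 s u v - pd I2 c u v * pd I1 s u v)).
    - unfold phi. pd_simpl N. rewrite !(pd_comm N) by auto. ring.
    - destruct (Dcs I1 u v Huv) as [-> ->]. destruct (Dcs I2 u v Huv) as [-> ->]. ring. }
  assert (D1 : forall a b, N (a, b) ->
     p I1 a b * r I2 a b - p I2 a b * r I1 a b <> 0).
  { intros a b Hab. unfold r.
    replace (_ - _) with (f a b * Delta a b) by (unfold Delta; ring).
    apply Rmult_integral_contrapositive_currified; auto. }
  rewrite (curvature_coframe N p r w h); auto.
  - pose proof (HDelta u v Huv) as D0. pose proof (f1 u v) as fn. pose proof (ff u v) as f2.
    pose proof (Dq u v Huv) as Eq.
    (* The numerator [f^2 - al^2] equals [1], which leaves [dg = d al / f^3]. *)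
    assert (Eg : forall i, pd i g u v = pd i al u v / (f u v * f u v * f u v)).
    { intros i. apply (Rmult_eq_reg_r (f u v)); [ | assumption ].
      transitivity (pd i al u v - g u v * pd i f u v); [ rewrite <- Dg by assumption; ring | ].
      replace (pd i f u v) with (al u v * pd i al u v / f u v)
        by (rewrite <- Df by assumption; field; assumption).
      unfold g. transitivity (pd i al u v * (f u v * f u v - al u v * al u v) / (f u v * f u v)).
      - field. assumption.
      - rewrite f2 at 1. field. assumption. }
    assert (Ew : pd I1 (w I2) u v - pd I2 (w I1) u v =
      - (pd I1 g u v * (phi I2 u v + 2 * q I2 u v)
         - pd I2 g u v * (phi I1 u v + 2 * q I1 u v))
      - g u v * (4 * al u v * Delta u v)).
    { unfold w. pd_simpl N.
      replace (pd I1 (phi I2) u v) with (pd I2 (phi I1) u v) by lra.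
      replace (pd I1 (q I2) u v) with (pd I2 (q I1) u v + 2 * al u v * Delta u v) by lra.
      ring. }
    rewrite Ew, !Eg.
    (* Expansions of [d al] and [phi] in the coframe [p, q]; the [q]-coefficient of [phi] comes from
       [Dal]. *)
    assert (Ea : forall i, pd i al u v = e1a * p i u v + wa * q i u v).
    { intros i. rewrite He, Hwa. unfold Delta in *. destruct i; field; assumption. }
    assert (Ephi : forall i, phi i u v = l * p i u v + (e1a + 2 * al u v * al u v) * q i u v).
    { intros i.
      assert (E : e1a + 2 * al u v * al u v =
        (p I1 u v * phi I2 u v - p I2 u v * phi I1 u v) / Delta u v).
      { apply (Rmult_eq_reg_r (Delta u v)); [ | assumption ].
        pose proof (Dal u v Huv).
        transitivity (p I1 u v * phi I2 u v - p I2 u v * phi I1 u v);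
          [ | field; assumption ].
        assert (e1a * Delta u v = q I2 u v * pd I1 al u v - q I1 u v * pd I2 al u v)
          by (rewrite He; field; assumption).
        lra. }
      rewrite E, Hl. unfold Delta in *. destruct i; field; assumption. }
    rewrite !Ea, !Ephi.
    replace (1 + al u v ^ 2) with (f u v * f u v) by (rewrite f2; ring).
    unfold r, g. unfold Delta in *.
    specialize (D1 u v Huv). unfold r in D1. clear - D0 D1 fn f2.
    transitivity (- (e1a * (e1a + 2 * al u v * al u v + 2) - wa * l
       + 4 * al u v * al u v * (f u v * f u v)) / (f u v * f u v * (f u v * f u v))).
    + field. auto.
    (* Only the term linear in [e1a] has to return from [f * f] to [al]; elsewhere both sides
       already agree. *)
    + replace (2 * (f u v * f u v) * e1a) with (2 * (1 + al u v * al u v) * e1a)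
        by (now rewrite f2).
      field. assumption.
  (* [dx^2 + dy^2 = p^2 + (al q)^2] by rotation, and [(al q)^2 + q^2 = r^2]. *)
  - intros i j a b Hab. rewrite Hh by assumption. unfold r.
    transitivity ((c a b * c a b + s a b * s a b) *
      (pd i x a b * pd j x a b + pd i y a b * pd j y a b) + q i a b * q j a b).
    { rewrite Hcs by assumption. ring. }
    transitivity (p i a b * p j a b + (f a b * f a b) * (q i a b * q j a b)); [ | ring ].
    rewrite ff.
    transitivity (p i a b * p j a b + (al a b * q i a b) * (al a b * q j a b) +
      q i a b * q j a b); [ | ring ].
    rewrite <- !Hal by assumption. unfold p. ring.
  (* The [2 q] part of [w] drops out against [r = f q]. *)
  - intros a b Hab. rewrite Dp by assumption. rewrite <- gf. unfold w, r. ring.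
  (* Multiplied by [f], the second structure equation reduces to [al] times [Dal]. *)
  - intros a b Hab. unfold r, w. pd_simpl N.
    apply (Rmult_eq_reg_r (f a b)); [ | apply f1 ].
    transitivity ((f a b * pd I1 f a b) * q I2 a b - (f a b * pd I2 f a b) * q I1 a b
      + f a b * f a b * (pd I1 (q I2) a b - pd I2 (q I1) a b)); [ ring | ].
    rewrite !Df, Dq, ff by assumption.
    transitivity (- (g a b * f a b) * (phi I1 a b * p I2 a b - phi I2 a b * p I1 a b)
      + 2 * (g a b * f a b) * Delta a b); [ | unfold Delta; ring ].
    rewrite gf.
    pose proof (f_equal (Rmult (al a b)) (Dal a b Hab)). lra.
Qed.

End AdaptedFrame.

(** * Tangent planes and regular points in a parametrization *)

(** The homeomorphism clause, applied to the whole domain, contains this. *)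
Lemma local_param_surface (Sigma : R3 -> Prop) (P : patch) (u v : R) :
  local_param Sigma P -> dom P (u, v) -> Sigma (P u v).
Proof.
  intros (Ho & _ & _ & _ & _ & _ & Hc) Huv.
  destruct (Hc (dom P) Ho (fun _ H => H)) as (V & _ & HV).
  apply (HV (P u v)). now exists u, v.
Qed.

(** The third component is traded for [theta0], which is linear in the vector. *)
Lemma tangent_tcomb (Sigma : R3 -> Prop) (P : patch) (u v : R) (w : R3) :
  local_param Sigma P -> dom P (u, v) -> tangent Sigma (P u v) w ->
  exists a b,
    a * pd I1 (fun s t => cx (P s t)) u v + b * pd I2 (fun s t => cx (P s t)) u v = cx w /\
    a * pd I1 (fun s t => cy (P s t)) u v + b * pd I2 (fun s t => cy (P s t)) u v = cy w /\
    a * theta0 (P u v) (tvec P I1 u v) + b * theta0 (P u v) (tvec P I2 u v) =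
      theta0 (P u v) w.
Proof.
  intros HP Huv [_ H]. destruct (H P u v HP Huv eq_refl) as (a & b & ->).
  exists a, b. unfold tcomb, vadd, vscal, tvec, theta0, cx, cy, cz; cbn.
  repeat split; ring.
Qed.

(** At a singular point [E1] and [E2] would be tangent; the coordinate vectors would then be
    combinations of them, and [theta0] would vanish on both. *)
Lemma regular_transverse (Sigma : R3 -> Prop) (P : patch) (u v : R) (i : index) :
  local_param Sigma P -> dom P (u, v) ->
  theta0 (P u v) (tvec P i u v) <> 0 -> regular Sigma (P u v).
Proof.
  intros HP Huv Hi. split; [ now apply local_param_surface | ].
  intros [_ Hs].
  assert (X1 : xi0 (P u v) (Defs.E1 (P u v))) by (unfold xi0, theta0, Defs.E1, cx, cy, cz; cbn; ring).
  assert (X2 : xi0 (P u v) (Defs.E2 (P u v))) by (unfold xi0, theta0, Defs.E2, cx, cy, cz; cbn; ring).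
  destruct (tangent_tcomb _ _ _ _ _ HP Huv (proj2 (Hs _) X1)) as (a & b & A1 & A2 & A3).
  destruct (tangent_tcomb _ _ _ _ _ HP Huv (proj2 (Hs _) X2)) as (a' & b' & B1 & B2 & B3).
  rewrite X1 in A3. rewrite X2 in B3.
  change (cx (Defs.E1 _)) with 1 in A1. change (cy (Defs.E1 _)) with 0 in A2.
  change (cx (Defs.E2 _)) with 0 in B1. change (cy (Defs.E2 _)) with 1 in B2.
  revert A1 A2 A3 B1 B2 B3 Hi.
  set (x1 := pd I1 (fun s t => cx (P s t)) u v). set (x2 := pd I2 (fun s t => cx (P s t)) u v).
  set (y1 := pd I1 (fun s t => cy (P s t)) u v). set (y2 := pd I2 (fun s t => cy (P s t)) u v).
  set (q1 := theta0 (P u v) (tvec P I1 u v)). set (q2 := theta0 (P u v) (tvec P I2 u v)).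
  intros A1 A2 A3 B1 B2 B3 Hi.
  assert (D : (a * b' - a' * b) * (x1 * y2 - x2 * y1) = 1).
  { transitivity ((a * x1 + b * x2) * (a' * y1 + b' * y2)
       - (a' * x1 + b' * x2) * (a * y1 + b * y2)); [ ring | ].
    rewrite A1, A2, B1, B2. ring. }
  apply Hi. destruct i; [ fold q1 | fold q2 ].
  - transitivity ((x1 * y2 - x2 * y1) *
      (b' * (a * q1 + b * q2) - b * (a' * q1 + b' * q2))).
    + rewrite <- (Rmult_1_l q1) at 1. rewrite <- D. ring.
    + rewrite A3, B3. ring.
  - transitivity ((x1 * y2 - x2 * y1) *
      (a * (a' * q1 + b' * q2) - a' * (a * q1 + b * q2))).
    + rewrite <- (Rmult_1_l q2) at 1. rewrite <- D. ring.
    + rewrite A3, B3. ring.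
Qed.

(** On [e1] and [alpha e2 + T] the form [p /\ q] takes the value [1], so it is nonzero on the
    coordinate basis, and [- s dx + c dy - alpha q] vanishes on both vectors, hence on the tangent
    plane. *)
Lemma adapted_frame_relations (Sigma : R3 -> Prop) (e1 : R3 -> R3) (alpha : R3 -> R)
  (P : patch) (u v : R) :
  characteristic_field Sigma e1 -> p_variation Sigma e1 alpha ->
  local_param Sigma P -> dom P (u, v) -> regular Sigma (P u v) ->
  let c := cx (e1 (P u v)) in
  let s := cy (e1 (P u v)) in
  let x i := pd i (fun s t => cx (P s t)) u v in
  let y i := pd i (fun s t => cy (P s t)) u v in
  let q i := theta0 (P u v) (tvec P i u v) in
  c * c + s * s = 1 /\
  (forall i, - s * x i + c * y i = alpha (P u v) * q i) /\
  (c * x I1 + s * y I1) * q I2 - (c * x I2 + s * y I2) * q I1 <> 0.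
Proof.
  intros [He _] Ha HP Huv Hreg c s x y q.
  destruct (He _ Hreg) as (Ht & Hx & Hm). specialize (Ha _ Hreg).
  destruct (tangent_tcomb _ _ _ _ _ HP Huv Ht) as (a1 & a2 & A1 & A2 & A3).
  destruct (tangent_tcomb _ _ _ _ _ HP Huv Ha) as (b1 & b2 & B1 & B2 & B3).
  unfold metric in Hm. rewrite Hx in A3, Hm.
  assert (Hcs : c * c + s * s = 1) by (unfold c, s; lra).
  assert (B1' : b1 * x I1 + b2 * x I2 = - alpha (P u v) * s).
  { unfold x. rewrite B1.
    unfold e2_of, J0, vadd, vscal, Defs.E1, Defs.E2, TT, s, cx, cy, cz; cbn. ring. }
  assert (B2' : b1 * y I1 + b2 * y I2 = alpha (P u v) * c).
  { unfold y. rewrite B2.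
    unfold e2_of, J0, vadd, vscal, Defs.E1, Defs.E2, TT, c, cx, cy, cz; cbn. ring. }
  assert (B3' : b1 * q I1 + b2 * q I2 = 1).
  { unfold q. rewrite B3.
    unfold theta0, e2_of, J0, vadd, vscal, Defs.E1, Defs.E2, TT, cx, cy, cz; cbn. ring. }
  fold (x I1) (x I2) c in A1. fold (y I1) (y I2) s in A2. fold (q I1) (q I2) in A3.
  set (al := alpha (P u v)) in *. clearbody x y q al c s.
  clear - Hcs A1 A2 A3 B1' B2' B3'.
  assert (D : (a1 * b2 - a2 * b1) *
    ((c * x I1 + s * y I1) * q I2 - (c * x I2 + s * y I2) * q I1) = 1).
  { transitivity ((c * (a1 * x I1 + a2 * x I2) + s * (a1 * y I1 + a2 * y I2)) *
        (b1 * q I1 + b2 * q I2)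
      - (c * (b1 * x I1 + b2 * x I2) + s * (b1 * y I1 + b2 * y I2)) *
        (a1 * q I1 + a2 * q I2)); [ ring | ].
    rewrite A1, A2, A3, B3', Hcs. ring. }
  split; [ assumption | split ].
  (* [m] is that vanishing form; [D] allows its coordinates to be solved for without division. *)
  - set (m i := - s * x i + c * y i - al * q i).
    assert (M1 : a1 * m I1 + a2 * m I2 = 0).
    { transitivity (- s * (a1 * x I1 + a2 * x I2) + c * (a1 * y I1 + a2 * y I2)
        - al * (a1 * q I1 + a2 * q I2)); [ unfold m; ring | ].
      rewrite A1, A2, A3. ring. }
    assert (M2 : b1 * m I1 + b2 * m I2 = 0).
    { transitivity (- s * (b1 * x I1 + b2 * x I2) + c * (b1 * y I1 + b2 * y I2)
        - al * (b1 * q I1 + b2 * q I2)); [ unfold m; ring | ].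
      rewrite B1', B2', B3'.
      transitivity (al * (c * c + s * s) - al); [ ring | rewrite Hcs; ring ]. }
    intros i. apply Rminus_diag_uniq. fold (m i).
    rewrite <- (Rmult_1_l (m i)), <- D.
    set (d := (c * x I1 + s * y I1) * q I2 - (c * x I2 + s * y I2) * q I1).
    destruct i.
    + transitivity (d * (b2 * (a1 * m I1 + a2 * m I2) - a2 * (b1 * m I1 + b2 * m I2)));
        [ ring | rewrite M1, M2; ring ].
    + transitivity (d * (a1 * (b1 * m I1 + b2 * m I2) - b1 * (a1 * m I1 + a2 * m I2)));
        [ ring | rewrite M1, M2; ring ].
  - intros E. rewrite E in D. lra.
Qed.

(** * The curvature formula *)

(** The leading minus sign goes with [gaussian_curvature] being positive on round spheres; the
    opposite sign convention for the curvature would remove it. *)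
Theorem theorem1p11 (Sigma : R3 -> Prop) (A : patch -> Prop)
  (e1 : R3 -> R3) (alpha : R3 -> R)
  (hS : oriented_surface Sigma A)
  (he1 : characteristic_field Sigma e1)
  (halpha : p_variation Sigma e1 alpha)
  (P : patch) (u v : R)
  (hP : local_param Sigma P) (huv : dom P (u, v)) (hreg : regular Sigma (P u v)) :
  let p := P u v in
  let a := alpha p in
  let l := p_mean_curvature P e1 u v in
  let e1a := deriv_along P u v (e1 p) alpha in
  let eSa := deriv_along P u v (e_Sigma e1 alpha p) alpha in
  gaussian_curvature (restricted_metric P) u v =
  - ((e1a ^ 2 + 2 * (1 + a ^ 2) * e1a + 4 * a ^ 2 * (1 + a ^ 2)
      - l * eSa * sqrt (1 + a ^ 2)) / (1 + a ^ 2) ^ 2).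
Proof.
  intros p0 a l e1a eSa.
  set (N := fun b : R * R => dom P b /\ regular Sigma (P (fst b) (snd b))).
  set (x := fun s t => cx (P s t)). set (y := fun s t => cy (P s t)).
  set (z := fun s t => cz (P s t)).
  set (c := fun s t => cx (e1 (P s t))). set (s := fun s t => cy (e1 (P s t))).
  set (al := fun s t => alpha (P s t)).
  set (q := fun i s t => pd i z s t + x s t * pd i y s t - y s t * pd i x s t).
  assert (Hrel : forall b1 b2, N (b1, b2) ->
    c b1 b2 * c b1 b2 + s b1 b2 * s b1 b2 = 1 /\
    (forall i, - s b1 b2 * pd i x b1 b2 + c b1 b2 * pd i y b1 b2 = al b1 b2 * q i b1 b2) /\
    (c b1 b2 * pd I1 x b1 b2 + s b1 b2 * pd I1 y b1 b2) * q I2 b1 b2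
    - (c b1 b2 * pd I2 x b1 b2 + s b1 b2 * pd I2 y b1 b2) * q I1 b1 b2 <> 0).
  { intros b1 b2 [Hd Hr].
    exact (adapted_frame_relations Sigma e1 alpha P b1 b2 he1 halpha hP Hd Hr). }
  pose proof hP as (Ho & Sx' & Sy' & Sz' & _).
  assert (HN : open N).
  { (* Where [q] does not vanish the point is regular, and [halpha] forces [q] not to
       vanish at regular points. *)
    intros [b1 b2] Hb. pose proof Hb as [Hd Hr].
    assert (Hq : exists i, q i b1 b2 <> 0).
    { destruct (Req_dec (q I1 b1 b2) 0) as [E1'|]; [ | now exists I1 ].
      exists I2. intros E2'. apply (proj2 (proj2 (Hrel b1 b2 Hb))).
      rewrite E1', E2'. ring. }
    destruct Hq as [i Hi].
    assert (Sq : smooth_on (dom P) (q i)) by (unfold q; smooth).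
    pose proof (continuity_2d_pt_neq_0 _ _ _ (proj1 (Sq b1 b2 Hd 0%nat)) Hi) as L.
    apply locally_2d_locally in L.
    generalize (filter_and _ _ L (Ho (b1, b2) Hd)). apply filter_imp.
    intros [t1 t2] [Hn Hd']. split; [ assumption | ].
    exact (regular_transverse Sigma P t1 t2 i hP Hd' Hn). }
  assert (Hdom : forall f, smooth_on (dom P) f -> smooth_on N f)
    by (intros f Hf b1 b2 [Hd _]; now apply Hf).
  assert (Sx : smooth_on N x) by now apply Hdom.
  assert (Sy : smooth_on N y) by now apply Hdom.
  assert (Sz : smooth_on N z) by now apply Hdom.
  assert (Sc : smooth_on N c) by exact (proj1 (proj2 he1) P hP).
  assert (Ss : smooth_on N s) by exact (proj1 (proj2 (proj2 he1)) P hP).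
  assert (Hqq : forall b1 b2, N (b1, b2) ->
    q I1 b1 b2 * q I1 b1 b2 + q I2 b1 b2 * q I2 b1 b2 <> 0).
  { intros b1 b2 Hb E. apply (proj2 (proj2 (Hrel b1 b2 Hb))).
    assert (q I1 b1 b2 = 0) as -> by nra. assert (q I2 b1 b2 = 0) as -> by nra. ring. }
  assert (Sal : smooth_on N al).
  (* Pairing the constraint [n = al q] with [q] expresses [al] through smooth functions. *)
  { set (n := fun i b1 b2 => - s b1 b2 * pd i x b1 b2 + c b1 b2 * pd i y b1 b2).
    apply (smooth_on_ext N HN (fun b1 b2 =>
      (n I1 b1 b2 * q I1 b1 b2 + n I2 b1 b2 * q I2 b1 b2) /
      (q I1 b1 b2 * q I1 b1 b2 + q I2 b1 b2 * q I2 b1 b2))).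
    - intros b1 b2 Hb. unfold n. rewrite !(proj1 (proj2 (Hrel b1 b2 Hb))).
      field. now apply Hqq.
    - unfold n. unfold q in *. smooth. }
  assert (Huv : N (u, v)) by (split; assumption).
  destruct (Hrel u v Huv) as (Hcs & Hal & HD).
  pose proof (proj1 (proj2 (proj1 he1 _ hreg))) as Hxi.
  set (pp := fun i => c u v * pd i x u v + s u v * pd i y u v).
  set (Delta := pp I1 * q I2 u v - pp I2 * q I1 u v).
  assert (F0 : 0 < 1 + al u v * al u v)
    by (pose proof (Rle_0_sqr (al u v)); unfold Rsqr in *; lra).
  assert (Hmet : forall i j, restricted_metric P i j u v =
    pp i * pp j + (1 + al u v * al u v) * (q i u v * q j u v)).
  { intros i j.
    transitivity ((c u v * c u v + s u v * s u v) *
      (pd i x u v * pd j x u v + pd i y u v * pd j y u v) + q i u v * q j u v).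
    { rewrite Hcs. unfold restricted_metric, metric.
      change (theta0 (P u v) (tvec P i u v)) with (q i u v).
      change (theta0 (P u v) (tvec P j u v)) with (q j u v).
      change (cx (tvec P i u v)) with (pd i x u v).
      change (cx (tvec P j u v)) with (pd j x u v).
      change (cy (tvec P i u v)) with (pd i y u v).
      change (cy (tvec P j u v)) with (pd j y u v). ring. }
    transitivity (pp i * pp j + (al u v * q i u v) * (al u v * q j u v) +
      q i u v * q j u v); [ | ring ].
    rewrite <- !Hal. unfold pp. ring. }
  assert (Hdet : det2 (restricted_metric P) u v = (1 + al u v * al u v) * (Delta * Delta)).
  { unfold det2. rewrite !Hmet. unfold Delta. ring. }
  (* The frame [e1, e_Sigma] is metrically dual to the coframe [p, f q]. *)
  assert (Hm1 : forall j, metric (P u v) (e1 (P u v)) (tvec P j u v) = pp j).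
  { intros j. unfold metric. rewrite Hxi.
    change (c u v * pd j x u v + s u v * pd j y u v + 0 * q j u v = pp j).
    unfold pp. ring. }
  assert (HmS : forall j, metric (P u v) (e_Sigma e1 alpha (P u v)) (tvec P j u v) =
    sqrt (1 + al u v ^ 2) * q j u v).
  { intros j.
    transitivity (/ sqrt (1 + al u v ^ 2) *
      (al u v * (- s u v * pd j x u v + c u v * pd j y u v) + q j u v)).
    - unfold metric.
      change (theta0 (P u v) (tvec P j u v)) with (q j u v).
      change (cx (tvec P j u v)) with (pd j x u v).
      change (cy (tvec P j u v)) with (pd j y u v).
      unfold theta0, e_Sigma, e2_of, J0, vadd, vscal, Defs.E1, Defs.E2, TT, c, s, al, cx, cy, cz; cbn.
      ring.
    - rewrite Hal.
      assert (G0 : 0 < 1 + al u v ^ 2) by (simpl; lra).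
      pose proof (sqrt_lt_R0 _ G0) as G1. pose proof (sqrt_sqrt _ (Rlt_le _ _ G0)) as G2.
      apply (Rmult_eq_reg_l (sqrt (1 + al u v ^ 2))); [ | lra ].
      rewrite <- !Rmult_assoc, G2, Rinv_r by lra. ring. }
  assert (HL1 : forall f, deriv_along P u v (e1 (P u v)) f =
    (q I2 u v * pd I1 (fun s t => f (P s t)) u v
     - q I1 u v * pd I2 (fun s t => f (P s t)) u v) / Delta).
  { intros f. unfold deriv_along, tcoord, sum2. rewrite !Hm1.
    unfold inv2. rewrite Hdet, !Hmet. unfold Delta in *. field.
    split; [ exact HD | lra ]. }
  (* The factor [sqrt (1 + alpha^2)] undoes the normalization, leaving the derivative along
     [alpha e2 + T]. *)
  assert (HLS : forall f, deriv_along P u v (e_Sigma e1 alpha (P u v)) f *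
      sqrt (1 + al u v ^ 2) =
    (pp I1 * pd I2 (fun s t => f (P s t)) u v
     - pp I2 * pd I1 (fun s t => f (P s t)) u v) / Delta).
  { intros f. unfold deriv_along, tcoord, sum2. rewrite !HmS.
    unfold inv2. rewrite Hdet, !Hmet. unfold Delta in *.
    assert (G0 : 0 <= 1 + al u v ^ 2) by (simpl; lra).
    pose proof (sqrt_sqrt _ G0) as G2.
    set (f' := sqrt (1 + al u v ^ 2)) in *.
    replace (1 + al u v * al u v) with (f' * f') in * by (rewrite G2; ring).
    assert (f' <> 0) by (intros E; rewrite E in F0; lra).
    field. split; [ exact HD | assumption ]. }
  (* [e2] is horizontal with components [(- s, c)], so [l = c (e1 s) - s (e1 c)], the value of [phi]
     on [e1]. *)
  assert (Hl : l = (q I2 u v * (c u v * pd I1 s u v - s u v * pd I1 c u v)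
     - q I1 u v * (c u v * pd I2 s u v - s u v * pd I2 c u v)) / Delta).
  { unfold l, p_mean_curvature, metric.
    replace (theta0 (P u v) (e2_of e1 (P u v))) with 0
      by (unfold theta0, e2_of, J0, vadd, vscal, Defs.E1, Defs.E2, cx, cy, cz; cbn; ring).
    replace (cx (e2_of e1 (P u v))) with (- s u v)
      by (unfold s, e2_of, J0, vadd, vscal, Defs.E1, Defs.E2, cx, cy, cz; cbn; ring).
    replace (cy (e2_of e1 (P u v))) with (c u v)
      by (unfold c, e2_of, J0, vadd, vscal, Defs.E1, Defs.E2, cx, cy, cz; cbn; ring).
    rewrite Rmult_0_r.
    change (deriv_along P u v (e1 (P u v)) (fun p => cx (e1 p)) * - s u v +
      deriv_along P u v (e1 (P u v)) (fun p => cy (e1 p)) * c u v + 0 =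
      (q I2 u v * (c u v * pd I1 s u v - s u v * pd I1 c u v)
       - q I1 u v * (c u v * pd I2 s u v - s u v * pd I2 c u v)) / Delta).
    rewrite !HL1. fold c s. field. exact HD. }
  (* Groups [eSa] with the root, which together form [wa]. *)
  rewrite (Rmult_assoc l).
  apply (curvature_adapted_frame N x y z c s al (restricted_metric P)); auto.
  - intros b1 b2 Hb. apply (Hrel b1 b2 Hb).
  - intros i b1 b2 Hb. apply (Hrel b1 b2 Hb).
  - intros b1 b2 Hb. apply (Hrel b1 b2 Hb).
  - exact (HL1 alpha).
  - exact (HLS alpha).
Qed.
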